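(* Any element $\alpha\in F_4$ can be represented as $\alpha=\alpha_1\alpha_2\alpha_1'$ with $\alpha_1,\alpha_1'\in Spin_1(9)$ and $\alpha_2\in Spin_2(9)$.
   Context: $\mathfrak{C}$ is the (real, 8-dimensional, division) Cayley algebra of octonions with conjugation $x\mapsto\overline{x}$. $\mathfrak{J}$ is the real vector space of $3\times3$ Hermitian matrices over $\mathfrak{C}$; its elements are written $$X=(\xi_1,\xi_2,\xi_3;x_1,x_2,x_3)=\begin{pmatrix}\xi_1&x_3&\overline{x_2}\\ \overline{x_3}&\xi_2&x_1\\ x_2&\overline{x_1}&\xi_3\end{pmatrix},\quad \xi_k\in\mathbb{R},\ x_k\in\mathfrak{C}.$$ Put $X\circ Y=\frac12(XY+YX)$, $\mathrm{tr}(X)=\xi_1+\xi_2+\xi_3$, $(X,Y)=\mathrm{tr}(X\circ Y)$, and define the Freudenthal product $$X\times Y=\tfrac12\bigl(2X\circ Y-\mathrm{tr}(X)Y-\mathrm{tr}(Y)X+(\mathrm{tr}(X)\mathrm{tr}(Y)-(X,Y))E\bigr),$$ where $E$ is the unit matrix. $\mathrm{Iso}_{\mathbb{R}}(\mathfrak{J})$ is the group of $\mathbb{R}$-linear automorphisms of the vector space $\mathfrak{J}$. The simply connected compact Lie group $F_4$ is $$F_4=\{\alpha\in\mathrm{Iso}_{\mathbb{R}}(\mathfrak{J})\mid \alpha(X\times Y)=\alpha X\times\alpha Y \text{ for all } X,Y\in\mathfrak{J}\}.$$ Let $E_1=(1,0,0;0,0,0)$, $E_2=(0,1,0;0,0,0)\in\mathfrak{J}$.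 For $k=1,2$, $Spin_k(9)=\{\alpha\in F_4\mid\alpha E_k=E_k\}$ (a subgroup isomorphic to the usual spinor group $Spin(9)$). *)

(* Defs.v *)
From HB Require Import structures.
From mathcomp Require Import all_boot all_order all_algebra.
From mathcomp Require Import reals.

Set Implicit Arguments.
Unset Strict Implicit.
Unset Printing Implicit Defensive.

Import GRing.Theory.
Local Open Scope ring_scope.

Section CayleyDickson.
Variable R : realType.

Fixpoint cd_dim (n : nat) : nat :=
  if n is m.+1 then (cd_dim m + cd_dim m)%N else 1%N.

(* The n-th Cayley-Dickson algebra over R (n = 0, 1, 2, 3 gives the reals,    *)
(* complex numbers, quaternions, octonions), as row vectors of coordinates;   *)
(* a row (a, b) of two halves stands for a + b e, with e the new unit.        *)
Definition cd (n : nat) := 'rV[R]_(cd_dim n).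

(* conj (a + b e) = conj a - b e *)
Fixpoint cd_conj (n : nat) : cd n -> cd n :=
  match n return cd n -> cd n with
  | 0 => id
  | m.+1 => fun x : 'rV[R]_(cd_dim m + cd_dim m) =>
      row_mx (cd_conj (lsubmx x : cd m)) (- rsubmx x)
  end.

(* (a + b e) (c + d e) = (a c - (conj d) b) + (b (conj c) + d a) e *)
Fixpoint cd_mul (n : nat) : cd n -> cd n -> cd n :=
  match n return cd n -> cd n -> cd n with
  | 0 => fun x y => \row_j (x 0 j * y 0 j)
  | m.+1 => fun x y : 'rV[R]_(cd_dim m + cd_dim m) =>
      let: a := (lsubmx x : cd m) in let: b := (rsubmx x : cd m) in
      let: c := (lsubmx y : cd m) in let: d := (rsubmx y : cd m) in
      row_mx (cd_mul a c - cd_mul (cd_conj d) b)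
             (cd_mul b (cd_conj c) + cd_mul d a)
  end.

Fixpoint cd_one (n : nat) : cd n :=
  match n return cd n with
  | 0 => const_mx 1
  | m.+1 => row_mx (cd_one m) 0
  end.

Fixpoint cd_re (n : nat) : cd n -> R :=
  match n return cd n -> R with
  | 0 => fun x => x 0 0
  | m.+1 => fun x : 'rV[R]_(cd_dim m + cd_dim m) => cd_re (lsubmx x : cd m)
  end.

Lemma cd_conjD n : {morph @cd_conj n : x y / x + y}.
Proof.
elim: n => [|n IHn] //= x y.
by rewrite linearD IHn linearD opprD -add_row_mx.
Qed.

Lemma cd_conjN n : {morph @cd_conj n : x / - x}.
Proof.
elim: n => [|n IHn] //= x.
by rewrite linearN IHn linearN -opp_row_mx.
Qed.

Lemma cd_conj0 n : @cd_conj n 0 = 0.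
Proof. by apply: (addrI (cd_conj 0)); rewrite -cd_conjD !addr0. Qed.

Lemma cd_conj1 n : cd_conj (cd_one n) = cd_one n.
Proof. by elim: n => [|n IHn] //=; rewrite row_mxKl row_mxKr IHn oppr0. Qed.

Lemma cd_conjK n : involutive (@cd_conj n).
Proof.
elim: n => [|n IHn] //= x.
by rewrite row_mxKl row_mxKr IHn opprK hsubmxK.
Qed.

Lemma cd_conjZ n (r : R) : {morph @cd_conj n : x / r *: x}.
Proof.
elim: n => [|n IHn] //= x.
by rewrite linearZ IHn linearZ -scalerN -scale_row_mx.
Qed.

Lemma cd_mulNN n (x y : cd n) :
  cd_mul (- x) y = - cd_mul x y /\ cd_mul x (- y) = - cd_mul x y.
Proof.
elim: n x y => [|n IHn] /= x y.
  by split; apply/rowP => j; rewrite !mxE ?mulNr ?mulrN.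
have mNl a b : cd_mul (- a) b = - cd_mul a b := (IHn a b).1.
have mNr a b : cd_mul a (- b) = - cd_mul a b := (IHn a b).2.
by split; rewrite !linearN /= ?cd_conjN ?(mNl, mNr) ?opp_row_mx !opprD.
Qed.

Lemma cd_mulNl n (x y : cd n) : cd_mul (- x) y = - cd_mul x y.
Proof. by case: (cd_mulNN x y). Qed.

Lemma cd_mulNr n (x y : cd n) : cd_mul x (- y) = - cd_mul x y.
Proof. by case: (cd_mulNN x y). Qed.

Lemma cd_conjM n (x y : cd n) :
  cd_conj (cd_mul x y) = cd_mul (cd_conj y) (cd_conj x).
Proof.
elim: n x y => [|n IHn] /= x y.
  by apply/rowP => j; rewrite !mxE mulrC.
rewrite !(row_mxKl, row_mxKr) cd_conjD !cd_conjN !IHn !cd_conjK.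
by rewrite !(cd_mulNl, cd_mulNr) opprK opprD [- _ - _]addrC.
Qed.

End CayleyDickson.

Arguments cd_conj : simpl never.
Arguments cd_mul : simpl never.
Arguments cd_one : simpl never.
Arguments cd_re : simpl never.

Section Jordan.
Variable R : realType.

Definition octonion := cd R 3.

Definition oreal (r : R) : octonion := r *: cd_one R 3.

Lemma conj_oreal r : cd_conj (oreal r) = oreal r.
Proof. by rewrite /oreal cd_conjZ cd_conj1. Qed.

(* Octonions are not a ring in the sense of the library (no associativity),   *)
(* so the matrix product over them has to be spelled out.                     *)
Definition omulmx (A B : 'M[octonion]_3) : 'M[octonion]_3 :=
  \matrix_(i, j) \sum_k cd_mul (A i k) (B k j).

Definition oscalemx (r : R) (A : 'M[octonion]_3) : 'M[octonion]_3 :=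
  map_mx ( *:%R r) A.

Definition oadjmx (A : 'M[octonion]_3) : 'M[octonion]_3 :=
  (map_mx (@cd_conj R 3) A)^T.

Lemma omulmxE A B i j :
  omulmx A B i j = \sum_k cd_mul (A i k) (B k j).
Proof. by rewrite mxE. Qed.

Lemma oscalemxE r A i j : oscalemx r A i j = r *: A i j.
Proof. by rewrite mxE. Qed.

Lemma oadjmxE A i j : oadjmx A i j = cd_conj (A j i).
Proof. by rewrite /oadjmx mxE mxE. Qed.

Definition hermitian : {pred 'M[octonion]_3} := [pred A | oadjmx A == A].

Record J := HermMx { mx_of_J :> 'M[octonion]_3; _ : mx_of_J \in hermitian }.

HB.instance Definition _ := [isSub for mx_of_J].
HB.instance Definition _ := [Choice of J by <:].

Lemma hermitianP (A : 'M[octonion]_3) :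
  reflect (forall i j, cd_conj (A j i) = A i j) (A \in hermitian).
Proof.
apply: (iffP eqP) => [hA i j|hA]; first by rewrite -oadjmxE hA.
by apply/matrixP => i j; rewrite oadjmxE hA.
Qed.

Fact hermitian_zmod : zmod_closed hermitian.
Proof.
split=> [|A B /hermitianP hA /hermitianP hB]; apply/hermitianP => i j.
  by rewrite !(mxE, cd_conj0).
have e k l : (A - B) k l = A k l - B k l by rewrite mxE [X in _ + X]mxE.
by rewrite !e cd_conjD cd_conjN hA hB.
Qed.

HB.instance Definition _ :=
  GRing.isZmodClosed.Build 'M[octonion]_3 hermitian hermitian_zmod.
HB.instance Definition _ := [SubChoice_isSubZmodule of J by <:].

Fact hermitian_scale r (X : J) : oscalemx r X \in hermitian.
Proof.
case: X => A /= /hermitianP hA; apply/hermitianP => i j.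
by rewrite !oscalemxE cd_conjZ hA.
Qed.

Definition scaleJ (r : R) (X : J) : J := HermMx (hermitian_scale r X).

Fact scaleJA a b X : scaleJ a (scaleJ b X) = scaleJ (a * b) X.
Proof. by apply/val_inj/matrixP => i j; rewrite !mxE scalerA. Qed.

Fact scale1J : left_id 1 scaleJ.
Proof. by move=> X; apply/val_inj/matrixP => i j; rewrite !mxE scale1r. Qed.

Fact scaleJDr : right_distributive scaleJ +%R.
Proof. by move=> a X Y; apply/val_inj/matrixP => i j; rewrite !mxE scalerDr. Qed.

Fact scaleJDl X : {morph scaleJ^~ X : a b / a + b}.
Proof. by move=> a b; apply/val_inj/matrixP => i j; rewrite !mxE scalerDl. Qed.

HB.instance Definition _ :=
  GRing.Zmodule_isLmodule.Build R J scaleJA scale1J scaleJDr scaleJDl.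

Definition triple_mx (xi1 xi2 xi3 : R) (x1 x2 x3 : octonion) :
    'M[octonion]_3 :=
  \matrix_(i, j) nth 0 (nth [::]
    [:: [:: oreal xi1; x3; cd_conj x2];
        [:: cd_conj x3; oreal xi2; x1];
        [:: x2; cd_conj x1; oreal xi3]] i) j.

Fact triple_herm xi1 xi2 xi3 x1 x2 x3 :
  triple_mx xi1 xi2 xi3 x1 x2 x3 \in hermitian.
Proof.
apply/hermitianP => i j; rewrite 2!mxE.
by case: i j => [[|[|[|//]]] ?] [[|[|[|//]]] ?] /=;
  rewrite ?cd_conjK ?conj_oreal.
Qed.

Definition mkJ xi1 xi2 xi3 x1 x2 x3 : J :=
  HermMx (triple_herm xi1 xi2 xi3 x1 x2 x3).

Fact jordan_herm (X Y : J) :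
  oscalemx 2^-1 (omulmx X Y + omulmx Y X) \in hermitian.
Proof.
have conjM (A B : J) i j :
    cd_conj (omulmx A B j i) = omulmx B A i j.
  case: A B => [A /= /hermitianP hA] [B /= /hermitianP hB].
  rewrite 2!omulmxE (big_morph _ (@cd_conjD R 3) (@cd_conj0 R 3)).
  by apply: eq_bigr => k _; rewrite cd_conjM hA hB.
apply/hermitianP => i j; rewrite !oscalemxE cd_conjZ; congr (_ *: _).
have e k l : (omulmx X Y + omulmx Y X) k l = omulmx X Y k l + omulmx Y X k l.
  by rewrite mxE.
by rewrite 2!e cd_conjD 2!conjM; apply: addrC.
Qed.

Definition jordan (X Y : J) : J := HermMx (jordan_herm X Y).

(* The diagonal entries of an element of J are real octonions. *)
Definition trJ (X : J) : R := \sum_i cd_re (mx_of_J X i i).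

Definition dotJ (X Y : J) : R := trJ (jordan X Y).

Definition EJ : J := mkJ 1 1 1 0 0 0.
Definition E1 : J := mkJ 1 0 0 0 0 0.
Definition E2 : J := mkJ 0 1 0 0 0 0.

Definition freudenthal (X Y : J) : J :=
  2^-1 *: (2 *: jordan X Y - trJ X *: Y - trJ Y *: X
           + (trJ X * trJ Y - dotJ X Y) *: EJ).

Definition IsoJ (f : J -> J) : Prop := linear f /\ bijective f.

Definition F4 (f : J -> J) : Prop :=
  IsoJ f /\ forall X Y, f (freudenthal X Y) = freudenthal (f X) (f Y).

Definition Spin1_9 (f : J -> J) : Prop := F4 f /\ f E1 = E1.
Definition Spin2_9 (f : J -> J) : Prop := F4 f /\ f E2 = E2.

End Jordan.

Arguments E1 {R}.
Arguments E2 {R}.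
Arguments EJ {R}.

(* Main.v *)
Require Import Defs.
From mathcomp Require Import all_boot all_order all_algebra.
From mathcomp Require Import reals.
From mathcomp Require Import ring lra.

(* For [c : R] and an octonion [u] with [c ^+ 2 + |u|^2 = 1], conjugation by  *)
(* the Hermitian involution [diag (1, [[c, u], [conj u, - c]])] lies in       *)
(* [Spin_1 (9)].  On the traceless part R^9 of the lower 2x2 block it acts as *)
(* v |-> 2 <w, v> w - v with w = (c, u), and such maps carry any vector to    *)
(* any other of the same norm, so one of them annihilates the entry xi_2 of a *)
(* given X with X x X = 0; that equation then kills x_1 and x_3 as well.      *)
(* Let X = alpha E_1.  Some beta in [Spin_1 (9)] makes xi_2 vanish; the       *)
(* cyclic conjugate of such a reflection lies in [Spin_2 (9)], and a suitable *)
(* one, gamma, makes xi_3 vanish, so that gamma (beta (alpha E_1)) = r E_1.   *)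
(* Comparing the eigenspaces of E_1 x _ gives r = 1, and                      *)
(* alpha = beta^-1 gamma^-1 (gamma beta alpha).                               *)

Set Implicit Arguments.
Unset Strict Implicit.
Unset Printing Implicit Defensive.

Import Order.TTheory GRing.Theory Num.Theory.
Local Open Scope ring_scope.

(** It suffices to find beta in [Spin1_9] and gamma in [Spin2_9] such that gamma beta alpha fixes
    E_1, for then gamma beta alpha is the last factor. F_4 preserves the cone X x X = 0, which
    contains E_1. On this cone the 2x2 minors vanish, as in xi_2 xi_3 = |x_1|^2, so once a diagonal
    entry of X is zero, the two octonions in its row are zero too ([sharp0_clear]). Two clearings,
    one by a reflection fixing E_1 and one by a reflection fixing E_2, leave a multiple of E_1
    ([Spin1_clear]); the multiple is 1 by [F4_scale_E1].

    The computational core is [refl_sharp]: the reflections preserve X x X. In place of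
    associativity it uses consequences of |x y| = |x| |y| ([oct_composition]): the cancellation law
    conj x (x y) = |x|^2 y, its polarisation, and a Moufang identity. By [F4_of_sharp], preserving
    the quadratic map X x X is enough for a linear bijection to lie in F_4. *)

Section CayleyDicksonTheory.
Variable R : realType.

(** * Cayley-Dickson doubling: bilinearity, unit and real part *)

Definition cd_pair n (a b : cd R n) : cd R n.+1 := row_mx a b.

Lemma cd_pairP n (x : cd R n.+1) : exists a b, x = cd_pair a b.
Proof. by exists (lsubmx x), (rsubmx x); rewrite /cd_pair hsubmxK. Qed.

Lemma cd_pairD n (a b c d : cd R n) :
  cd_pair a b + cd_pair c d = cd_pair (a + c) (b + d).
Proof. exact: add_row_mx. Qed.

Lemma cd_pairZ n r (a b : cd R n) :
  r *: cd_pair a b = cd_pair (r *: a) (r *: b).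
Proof. exact: scale_row_mx. Qed.

Lemma cd_pair0 n : cd_pair 0 0 = 0 :> cd R n.+1.
Proof. exact: row_mx0. Qed.

Lemma cd_pairM n (a b c d : cd R n) :
  cd_mul (cd_pair a b) (cd_pair c d) =
  cd_pair (cd_mul a c - cd_mul (cd_conj d) b)
          (cd_mul b (cd_conj c) + cd_mul d a).
Proof. by rewrite /cd_pair {1}/cd_mul /= !(row_mxKl, row_mxKr). Qed.

Lemma cd_pair_conj n (a b : cd R n) :
  cd_conj (cd_pair a b) = cd_pair (cd_conj a) (- b).
Proof. by rewrite /cd_pair {1}/cd_conj /= !(row_mxKl, row_mxKr). Qed.

Lemma cd_pair_re n (a b : cd R n) : cd_re (cd_pair a b) = cd_re a.
Proof. by rewrite /cd_pair {1}/cd_re /= row_mxKl. Qed.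

Lemma cd_mul0E (x y : cd R 0) : cd_mul x y = \row_j (x 0 j * y 0 j).
Proof. by []. Qed.

Lemma cd_re0E (x : cd R 0) : cd_re x = x 0 0.
Proof. by []. Qed.

Lemma cd_conj0E (x : cd R 0) : cd_conj x = x.
Proof. by []. Qed.

Lemma cd_mulD n (x y z : cd R n) :
  cd_mul (x + y) z = cd_mul x z + cd_mul y z /\
  cd_mul z (x + y) = cd_mul z x + cd_mul z y.
Proof.
elim: n x y z => [|n IHn] x y z.
  by rewrite !cd_mul0E; split; apply/rowP => j; rewrite !mxE (mulrDl, mulrDr).
have Dl a b c : cd_mul (a + b) c = cd_mul a c + cd_mul b c := (IHn a b c).1.
have Dr a b c : cd_mul c (a + b) = cd_mul c a + cd_mul c b := (IHn a b c).2.
have [[x1 [x2 ->]] [y1 [y2 ->]]] := (cd_pairP x, cd_pairP y).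
have [z1 [z2 ->]] := cd_pairP z.
rewrite !(cd_pairM, cd_pairD) !cd_conjD !(Dl, Dr) !opprD.
by split; congr cd_pair; rewrite addrACA.
Qed.

Lemma cd_mulDl n (x y z : cd R n) :
  cd_mul (x + y) z = cd_mul x z + cd_mul y z.
Proof. by case: (cd_mulD x y z). Qed.

Lemma cd_mulDr n (x y z : cd R n) :
  cd_mul x (y + z) = cd_mul x y + cd_mul x z.
Proof. by case: (cd_mulD y z x). Qed.

Lemma cd_mulZ n r (x y : cd R n) :
  cd_mul (r *: x) y = r *: cd_mul x y /\ cd_mul x (r *: y) = r *: cd_mul x y.
Proof.
elim: n x y => [|n IHn] x y.
  rewrite !cd_mul0E; split; apply/rowP => j; rewrite !mxE.
    by rewrite mulrA.
  by rewrite mulrCA.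
have Zl a b : cd_mul (r *: a) b = r *: cd_mul a b := (IHn a b).1.
have Zr a b : cd_mul a (r *: b) = r *: cd_mul a b := (IHn a b).2.
have [[x1 [x2 ->]] [y1 [y2 ->]]] := (cd_pairP x, cd_pairP y).
rewrite !(cd_pairM, cd_pairZ) !cd_conjZ !(Zl, Zr) !scalerDr !scalerN;
  split; reflexivity.
Qed.

Lemma cd_mulZl n r (x y : cd R n) : cd_mul (r *: x) y = r *: cd_mul x y.
Proof. by case: (cd_mulZ r x y). Qed.

Lemma cd_mulZr n r (x y : cd R n) : cd_mul x (r *: y) = r *: cd_mul x y.
Proof. by case: (cd_mulZ r x y). Qed.

Lemma cd_mul0l n (x : cd R n) : cd_mul 0 x = 0.
Proof. by rewrite -(scale0r 0) cd_mulZl !scale0r. Qed.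

Lemma cd_mul0r n (x : cd R n) : cd_mul x 0 = 0.
Proof. by rewrite -(scale0r 0) cd_mulZr !scale0r. Qed.

Lemma cd_mulBl n (x y z : cd R n) :
  cd_mul (x - y) z = cd_mul x z - cd_mul y z.
Proof. by rewrite cd_mulDl cd_mulNl. Qed.

Lemma cd_mulBr n (x y z : cd R n) :
  cd_mul x (y - z) = cd_mul x y - cd_mul x z.
Proof. by rewrite cd_mulDr cd_mulNr. Qed.

Lemma cd_reD n (x y : cd R n) : cd_re (x + y) = cd_re x + cd_re y.
Proof.
elim: n x y => [|n IHn] x y; first by rewrite !cd_re0E mxE.
have [[x1 [x2 ->]] [y1 [y2 ->]]] := (cd_pairP x, cd_pairP y).
by rewrite cd_pairD !cd_pair_re IHn.
Qed.

Lemma cd_reZ n r (x : cd R n) : cd_re (r *: x) = r * cd_re x.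
Proof.
elim: n x => [|n IHn] x; first by rewrite !cd_re0E mxE.
have [x1 [x2 ->]] := cd_pairP x.
by rewrite cd_pairZ !cd_pair_re IHn.
Qed.

Lemma cd_reN n (x : cd R n) : cd_re (- x) = - cd_re x.
Proof. by rewrite -scaleN1r cd_reZ mulN1r. Qed.

Lemma cd_re0 n : cd_re (0 : cd R n) = 0.
Proof. by rewrite -(scale0r 0) cd_reZ mul0r. Qed.

Lemma cd_re_one n : cd_re (cd_one R n) = 1.
Proof.
elim: n => [|n IHn]; first by rewrite cd_re0E mxE.
by rewrite [cd_one _ _]/(cd_pair _ 0) cd_pair_re.
Qed.

Lemma cd_re_conj n (x : cd R n) : cd_re (cd_conj x) = cd_re x.
Proof.
elim: n x => [|n IHn] x; first by [].
by have [x1 [x2 ->]] := cd_pairP x; rewrite cd_pair_conj !cd_pair_re IHn.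
Qed.

Lemma cd_mul1 n (x : cd R n) :
  cd_mul (cd_one R n) x = x /\ cd_mul x (cd_one R n) = x.
Proof.
elim: n x => [|n IHn] x.
  by rewrite !cd_mul0E; split; apply/rowP => j; rewrite !mxE (mul1r, mulr1).
have [x1 [x2 ->]] := cd_pairP x; rewrite [cd_one _ _]/(cd_pair _ 0).
rewrite !cd_pairM cd_conj1 !cd_conj0 !(cd_mul0l, cd_mul0r) !subr0 add0r addr0.
by have [[-> ->] [_ ->]] := (IHn x1, IHn x2).
Qed.

Lemma cd_mul1l n (x : cd R n) : cd_mul (cd_one R n) x = x.
Proof. by case: (cd_mul1 x). Qed.

Lemma cd_mul1r n (x : cd R n) : cd_mul x (cd_one R n) = x.
Proof. by case: (cd_mul1 x). Qed.

Lemma cd_conj_fixed n (x : cd R n) :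
  cd_conj x = x -> x = cd_re x *: cd_one R n.
Proof.
elim: n x => [|n IHn] x; last have [x1 [x2 ->]] := cd_pairP x.
  by move=> _; apply/rowP => j; rewrite !mxE mulr1 ord1.
rewrite cd_pair_conj cd_pair_re [cd_one _ _]/(cd_pair _ 0) cd_pairZ.
rewrite scaler0 => /eq_row_mx[/IHn <- /eqP].
rewrite -subr_eq0 -opprD oppr_eq0 -mulr2n -scaler_nat scaler_eq0 pnatr_eq0 /=.
by move/eqP->.
Qed.

Lemma cd_reC n (x y : cd R n) : cd_re (cd_mul x y) = cd_re (cd_mul y x).
Proof.
elim: n x y => [|n IHn] x y.
  by rewrite !cd_mul0E !cd_re0E !mxE mulrC.
have [[x1 [x2 ->]] [y1 [y2 ->]]] := (cd_pairP x, cd_pairP y).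
rewrite !cd_pairM !cd_pair_re !cd_reD !cd_reN IHn; congr (_ - _).
by rewrite -cd_re_conj cd_conjM cd_conjK.
Qed.

(** The real part is associative at every level, although the product is not: after expansion, the
    terms match up to cyclic rotations of real parts of triple products one level below. This makes
    multiplication by conj y the adjoint of multiplication by y. *)
Lemma cd_reA n (x y z : cd R n) :
  cd_re (cd_mul (cd_mul x y) z) = cd_re (cd_mul x (cd_mul y z)).
Proof.
elim: n x y z => [|n IHn] x y z.
  by rewrite !cd_mul0E !cd_re0E !mxE mulrA.
have [[x1 [x2 ->]] [y1 [y2 ->]]] := (cd_pairP x, cd_pairP y).
have [z1 [z2 ->]] := cd_pairP z.
have rot (a b c : cd R n) :
    cd_re (cd_mul (cd_mul a b) c) = cd_re (cd_mul (cd_mul b c) a).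
  by rewrite IHn cd_reC.
rewrite !cd_pairM !cd_pair_re cd_mulBl cd_mulBr !(cd_conjD, cd_conjM, cd_conjK).
rewrite !(cd_mulDl, cd_mulDr) !(cd_reD, cd_reN) -!IHn.
rewrite (rot x1 (cd_conj z2)) (rot z1) (rot (cd_conj y1)); ring.
Qed.

(** * The Euclidean inner product *)

Definition cd_dot n (x y : cd R n) : R := cd_re (cd_mul x (cd_conj y)).

Lemma cd_dotC n (x y : cd R n) : cd_dot x y = cd_dot y x.
Proof. by rewrite /cd_dot -cd_re_conj cd_conjM cd_conjK. Qed.

Lemma cd_dotDl n (x y z : cd R n) : cd_dot (x + y) z = cd_dot x z + cd_dot y z.
Proof. by rewrite /cd_dot cd_mulDl cd_reD. Qed.

Lemma cd_dotDr n (x y z : cd R n) : cd_dot x (y + z) = cd_dot x y + cd_dot x z.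
Proof. by rewrite ![cd_dot x _]cd_dotC cd_dotDl. Qed.

Lemma cd_dotZl n r (x y : cd R n) : cd_dot (r *: x) y = r * cd_dot x y.
Proof. by rewrite /cd_dot cd_mulZl cd_reZ. Qed.

Lemma cd_dotZr n r (x y : cd R n) : cd_dot x (r *: y) = r * cd_dot x y.
Proof. by rewrite ![cd_dot x _]cd_dotC cd_dotZl. Qed.

Lemma cd_dotNl n (x y : cd R n) : cd_dot (- x) y = - cd_dot x y.
Proof. by rewrite -scaleN1r cd_dotZl mulN1r. Qed.

Lemma cd_dotNr n (x y : cd R n) : cd_dot x (- y) = - cd_dot x y.
Proof. by rewrite ![cd_dot x _]cd_dotC cd_dotNl. Qed.

Lemma cd_dot0l n (x : cd R n) : cd_dot 0 x = 0.
Proof. by rewrite -(scale0r 0) cd_dotZl mul0r. Qed.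

Lemma cd_dot0r n (x : cd R n) : cd_dot x 0 = 0.
Proof. by rewrite cd_dotC cd_dot0l. Qed.

Lemma cd_dot_conj n (x y : cd R n) :
  cd_dot (cd_conj x) (cd_conj y) = cd_dot x y.
Proof. by rewrite cd_dotC /cd_dot cd_conjK cd_reC. Qed.

Lemma cd_dot_mulr n (x y z : cd R n) :
  cd_dot (cd_mul x y) z = cd_dot x (cd_mul z (cd_conj y)).
Proof. by rewrite /cd_dot cd_reA cd_conjM cd_conjK. Qed.

Lemma cd_dot_mull n (x y z : cd R n) :
  cd_dot (cd_mul x y) z = cd_dot y (cd_mul (cd_conj x) z).
Proof. by rewrite /cd_dot cd_conjM cd_conjK cd_reA cd_reC cd_reA. Qed.

Lemma cd_pair_dot n (a b c d : cd R n) :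
  cd_dot (cd_pair a b) (cd_pair c d) = cd_dot a c + cd_dot b d.
Proof.
rewrite /cd_dot cd_pair_conj cd_pairM cd_pair_re cd_reD cd_conjN cd_mulNl opprK.
by rewrite (cd_reC _ b).
Qed.

Lemma cd_dot_def n (x : cd R n) : 0 <= cd_dot x x /\ (cd_dot x x = 0 -> x = 0).
Proof.
elim: n x => [|n IHn] x.
  rewrite /cd_dot cd_mul0E cd_re0E cd_conj0E mxE -expr2 sqr_ge0; split=> //.
  move/eqP; rewrite sqrf_eq0 => /eqP x0.
  by apply/rowP => j; rewrite ord1 x0 mxE.
have [a [b ->]] := cd_pairP x; rewrite cd_pair_dot.
have [[a_ge0 a0] [b_ge0 b0]] := (IHn a, IHn b).
split=> [|/eqP]; first exact: addr_ge0.
by rewrite paddr_eq0 // => /andP[/eqP/a0-> /eqP/b0->]; rewrite cd_pair0.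
Qed.

Lemma cd_dot_ge0 n (x : cd R n) : 0 <= cd_dot x x.
Proof. by case: (cd_dot_def x). Qed.

Lemma cd_dot_eq0 n (x : cd R n) : cd_dot x x = 0 -> x = 0.
Proof. by case: (cd_dot_def x). Qed.

Lemma cd_dot_inj n (x y : cd R n) :
  (forall z, cd_dot x z = cd_dot y z) -> x = y.
Proof.
move=> xy; apply/subr0_eq/cd_dot_eq0.
by rewrite cd_dotDl cd_dotNl xy subrr.
Qed.

(** * The composition property, from the reals up to the octonions *)

Definition cd_assoc n :=
  forall x y z : cd R n, cd_mul (cd_mul x y) z = cd_mul x (cd_mul y z).

Definition cd_comm n := forall x y : cd R n, cd_mul x y = cd_mul y x.

Definition cd_composition n :=
  forall x y : cd R n,
    cd_dot (cd_mul x y) (cd_mul x y) = cd_dot x x * cd_dot y y.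

Lemma cd_comm0 : cd_comm 0.
Proof.
by move=> x y; rewrite !cd_mul0E; apply/rowP => j; rewrite !mxE mulrC.
Qed.

Lemma cd_assoc0 : cd_assoc 0.
Proof.
by move=> x y z; rewrite !cd_mul0E; apply/rowP => j; rewrite !mxE mulrA.
Qed.

Lemma cd_composition0 : cd_composition 0.
Proof.
by move=> x y; rewrite /cd_dot !cd_mul0E !cd_re0E !cd_conj0E !mxE mulrACA.
Qed.

Lemma cd_comm1 : cd_comm 1.
Proof.
move=> x y; have [[a [b ->]] [c [d ->]]] := (cd_pairP x, cd_pairP y).
rewrite !cd_pairM !cd_conj0E (cd_comm0 c a) (cd_comm0 b d).
by congr cd_pair; apply: addrC.
Qed.

Lemma cd_assocS n : cd_comm n -> cd_assoc n -> cd_assoc n.+1.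
Proof.
move=> mC mA x y z.
have [[x1 [x2 ->]] [y1 [y2 ->]]] := (cd_pairP x, cd_pairP y).
have [z1 [z2 ->]] := cd_pairP z.
have mCA (a b c : cd R n) : cd_mul a (cd_mul b c) = cd_mul b (cd_mul a c).
  by rewrite -!mA (mC a b).
rewrite !cd_pairM !(cd_mulBl, cd_mulBr, cd_mulDl, cd_mulDr).
rewrite !(cd_conjD, cd_conjN, cd_conjM, cd_conjK).
rewrite !(cd_mulBl, cd_mulBr, cd_mulDl, cd_mulDr).
rewrite !mA (mCA x1 (cd_conj z2)) (mC x1 y2) (mCA z1) (mC z1 x2).
rewrite (mCA (cd_conj y1)) (mC (cd_conj y1) x2) (mC (cd_conj z1) (cd_conj y1)).
rewrite (mC (cd_conj z1) x1) (mC y1 x1) (mCA z2 (cd_conj y2)) (mC z2 x2).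
rewrite (mCA x2 (cd_conj y2)).
congr cd_pair; last by rewrite [X in _ + X = _]addrC addrACA.
by rewrite !opprD [X in _ + X = _]addrC addrACA.
Qed.

(** Expanding the norm of the product leaves two cross terms of opposite sign. Taking adjoints
    rewrites them as the pairings of a with (conj d b) conj c and with conj d (b conj c), which
    agree by associativity one level below. *)
Lemma cd_compositionS n : cd_assoc n -> cd_composition n -> cd_composition n.+1.
Proof.
move=> mA mN x y; have [[a [b ->]] [c [d ->]]] := (cd_pairP x, cd_pairP y).
rewrite cd_pairM !cd_pair_dot !(cd_dotDl, cd_dotDr, cd_dotNl, cd_dotNr) !mN.
rewrite !cd_dot_conj (cd_dotC _ (cd_mul a c)) (cd_dotC _ (cd_mul b _)).
suff <-: cd_dot (cd_mul a c) (cd_mul (cd_conj d) b) =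
  cd_dot (cd_mul b (cd_conj c)) (cd_mul d a) by ring.
by rewrite [RHS]cd_dotC [RHS]cd_dot_mull cd_dot_mulr mA.
Qed.

(** Only the level below has to be associative, and the quaternions still are. *)
Lemma oct_composition : cd_composition 3.
Proof.
apply: cd_compositionS.
  exact: cd_assocS cd_comm1 (cd_assocS cd_comm0 cd_assoc0).
apply: cd_compositionS; first exact: cd_assocS cd_comm0 cd_assoc0.
exact: cd_compositionS cd_assoc0 cd_composition0.
Qed.

(** * Identities valid in any composition algebra of the tower *)

Section Composition.
Variables (n : nat) (mN : @cd_composition n).
Implicit Types u x y z : cd R n.

Lemma cd_dotMr x z y :
  cd_dot (cd_mul x y) (cd_mul x z) = cd_dot x x * cd_dot y z.
Proof.
have := mN x (y + z); rewrite cd_mulDr !(cd_dotDl, cd_dotDr) !mN.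
rewrite (cd_dotC (cd_mul x z)) (cd_dotC z y); lra.
Qed.

(** This stands in for associativity. Pairing with z and moving conj x to the other side turns it
    into [cd_dotMr]. *)
Lemma cd_conjKM x y : cd_mul (cd_conj x) (cd_mul x y) = cd_dot x x *: y.
Proof.
apply: cd_dot_inj => z.
by rewrite cd_dot_mull cd_conjK cd_dotMr cd_dotZl.
Qed.

Lemma cd_mul_conjK x y : cd_mul (cd_mul y x) (cd_conj x) = cd_dot x x *: y.
Proof.
have := cd_conjKM (cd_conj x) (cd_conj y); rewrite cd_dot_conj.
by move/(congr1 (@cd_conj R n)); rewrite cd_conjZ !cd_conjM !cd_conjK.
Qed.

Lemma cd_conjKM_lin u x y :
  cd_mul (cd_conj u) (cd_mul x y) + cd_mul (cd_conj x) (cd_mul u y) =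
  (2 * cd_dot u x) *: y.
Proof.
have := cd_conjKM (u + x) y.
rewrite cd_conjD !cd_mulDl !cd_mulDr !cd_conjKM !(cd_dotDl, cd_dotDr).
rewrite (cd_dotC x u) !scalerDl -!addrA => /addrI.
by rewrite !addrA => /addIr->; rewrite -scalerDl; congr (_ *: _); ring.
Qed.

Lemma cd_mul_conjK_lin u x y :
  cd_mul (cd_mul y x) (cd_conj u) + cd_mul (cd_mul y u) (cd_conj x) =
  (2 * cd_dot u x) *: y.
Proof.
have := cd_conjKM_lin (cd_conj u) (cd_conj x) (cd_conj y); rewrite cd_dot_conj.
move/(congr1 (@cd_conj R n)).
by rewrite cd_conjZ cd_conjD !cd_conjM !cd_conjK.
Qed.

Lemma cd_dot_exchange x y z w :
  cd_dot (cd_mul x y) (cd_mul z w) + cd_dot (cd_mul x w) (cd_mul z y) =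
  2 * cd_dot x z * cd_dot y w.
Proof.
have := cd_dotMr (x + z) w y.
rewrite !cd_mulDl !(cd_dotDl, cd_dotDr) !cd_dotMr.
rewrite (cd_dotC (cd_mul x w)) (cd_dotC z x) (cd_dotC (cd_mul z y)); lra.
Qed.

(** The right side is u (x y) u written through the inner product, so this is the middle Moufang
    identity. Paired with z, it is [cd_dot_exchange] combined with conj (u x) u = |u|^2 conj x. *)
Lemma cd_moufang u x y :
  cd_mul (cd_mul u x) (cd_mul y u) =
  (2 * cd_dot u (cd_conj (cd_mul x y))) *: u
  - cd_dot u u *: cd_conj (cd_mul x y).
Proof.
apply: cd_dot_inj => z; rewrite cd_dotDl cd_dotNl !cd_dotZl cd_dot_mull.
have uxu: cd_mul (cd_conj (cd_mul u x)) u = cd_dot u u *: cd_conj x.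
  have := cd_mul_conjK (cd_conj u) (cd_conj x).
  by rewrite cd_conjK cd_dot_conj -cd_conjM.
have := cd_dot_exchange y u (cd_conj (cd_mul u x)) z.
rewrite uxu cd_dotZr (cd_dot_mull y z) -[cd_dot y _]cd_dot_conj cd_conjK.
rewrite [cd_dot (cd_conj y) _]cd_dotC (cd_dot_mulr u x) -!cd_conjM.
rewrite (cd_dotC z (cd_conj _)); lra.
Qed.

End Composition.

End CayleyDicksonTheory.

(* Otherwise [/=] evaluates the dimension of the octonions inside types. *)
Local Arguments cd_dim : simpl never.

(** Products and conjugates become opaque vectors, so this settles identities that are linear in
    them, coordinate by coordinate. *)
Ltac vring :=
  repeat match goal with |- context [cd_mul ?a ?b] =>
    let p := fresh "p" in set p := cd_mul a b; clearbody p end;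
  repeat match goal with |- context [cd_conj ?a] =>
    let p := fresh "p" in set p := cd_conj a; clearbody p end;
  apply/rowP => ?; rewrite !mxE; ring.

(* On the concrete index 3 unification unfolds [cd_dim] and the products, *)
(* which is intractable; over a generic index these are inert.            *)
Ltac generic_index :=
  repeat match goal with
  | x : octonion _ |- _ => generalize dependent x
  | x : @cd_composition _ _ |- _ => generalize dependent x
  end;
  rewrite /octonion; move: {+}3%N => ?; intros.

(** * Coordinates on [J] and the Freudenthal product *)

Section JordanCoordinates.
Variable R : realType.
Local Notation O := (octonion R).
Implicit Types (X Y Z : J R) (x y z : O).

Definition entry i j X : O := mx_of_J X (inord i) (inord j).
Definition xi1 X := cd_re (entry 0 0 X).
Definition xi2 X := cd_re (entry 1 1 X).
Definition xi3 X := cd_re (entry 2 2 X).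
Definition oc1 := entry 1 2.
Definition oc2 := entry 2 0.
Definition oc3 := entry 0 1.

Lemma entry_conj i j X : cd_conj (entry i j X) = entry j i X.
Proof. by case: X => A hA; apply: (hermitianP _ hA). Qed.

Lemma entryD i j X Y : entry i j (X + Y) = entry i j X + entry i j Y.
Proof. by rewrite /entry mxE. Qed.

Lemma entryZ i j r X : entry i j (r *: X) = r *: entry i j X.
Proof. by rewrite /entry mxE. Qed.

Lemma entry_mkJ i j a1 a2 a3 x1 x2 x3 : (i < 3)%N -> (j < 3)%N ->
  entry i j (mkJ a1 a2 a3 x1 x2 x3) =
  nth 0 (nth [::] [:: [:: oreal a1; x3; cd_conj x2];
                      [:: cd_conj x3; oreal a2; x1];
                      [:: x2; cd_conj x1; oreal a3]] i) j.
Proof. by move=> i3 j3; rewrite /entry mxE !inordK. Qed.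

Lemma entry_jordan i j X Y :
  entry i j (jordan X Y) = 2^-1 *:
  (cd_mul (entry i 0 X) (entry 0 j Y) + cd_mul (entry i 1 X) (entry 1 j Y)
   + cd_mul (entry i 2 X) (entry 2 j Y)
   + (cd_mul (entry i 0 Y) (entry 0 j X) + cd_mul (entry i 1 Y) (entry 1 j X)
      + cd_mul (entry i 2 Y) (entry 2 j X))).
Proof.
have sum3 (F : 'I_3 -> O) :
    \sum_k F k = F (inord 0) + F (inord 1) + F (inord 2).
  rewrite !big_ord_recl big_ord0 addr0 addrA.
  by do ![congr (_ + _) | congr (F _)]; apply/val_inj; rewrite /= !inordK.
by rewrite /entry /= oscalemxE mxE !omulmxE !sum3.
Qed.

Lemma oreal_re x : cd_conj x = x -> oreal (cd_re x) = x.
Proof. by move/cd_conj_fixed => {2}->. Qed.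

Lemma re_oreal (r : R) : cd_re (oreal r) = r.
Proof. by rewrite /oreal cd_reZ cd_re_one mulr1. Qed.

Lemma oreal_mull r x : cd_mul (oreal r) x = r *: x.
Proof. by rewrite /oreal cd_mulZl cd_mul1l. Qed.

Lemma oreal_mulr r x : cd_mul x (oreal r) = r *: x.
Proof. by rewrite /oreal cd_mulZr cd_mul1r. Qed.

Lemma mkJ_xi1 a1 a2 a3 x1 x2 x3 : xi1 (mkJ a1 a2 a3 x1 x2 x3) = a1.
Proof. by rewrite /xi1 entry_mkJ // re_oreal. Qed.
Lemma mkJ_xi2 a1 a2 a3 x1 x2 x3 : xi2 (mkJ a1 a2 a3 x1 x2 x3) = a2.
Proof. by rewrite /xi2 entry_mkJ // re_oreal. Qed.
Lemma mkJ_xi3 a1 a2 a3 x1 x2 x3 : xi3 (mkJ a1 a2 a3 x1 x2 x3) = a3.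
Proof. by rewrite /xi3 entry_mkJ // re_oreal. Qed.
Lemma mkJ_oc1 a1 a2 a3 x1 x2 x3 : oc1 (mkJ a1 a2 a3 x1 x2 x3) = x1.
Proof. by rewrite /oc1 entry_mkJ. Qed.
Lemma mkJ_oc2 a1 a2 a3 x1 x2 x3 : oc2 (mkJ a1 a2 a3 x1 x2 x3) = x2.
Proof. by rewrite /oc2 entry_mkJ. Qed.
Lemma mkJ_oc3 a1 a2 a3 x1 x2 x3 : oc3 (mkJ a1 a2 a3 x1 x2 x3) = x3.
Proof. by rewrite /oc3 entry_mkJ. Qed.

Definition mkJE := (mkJ_xi1, mkJ_xi2, mkJ_xi3, mkJ_oc1, mkJ_oc2, mkJ_oc3).

Lemma mkJ_eta X : mkJ (xi1 X) (xi2 X) (xi3 X) (oc1 X) (oc2 X) (oc3 X) = X.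
Proof.
apply/val_inj/matrixP => i j; rewrite mxE -[i]inord_val -[j]inord_val.
case: i j => [[|[|[|//]]] i3] [[|[|[|//]]] j3] /=; rewrite !inordK //=.
all: by rewrite ?oreal_re ?entry_conj.
Qed.

Lemma J_ext X Y : xi1 X = xi1 Y -> xi2 X = xi2 Y -> xi3 X = xi3 Y ->
  oc1 X = oc1 Y -> oc2 X = oc2 Y -> oc3 X = oc3 Y -> X = Y.
Proof.
move=> e1 e2 e3 e4 e5 e6.
by rewrite -[LHS]mkJ_eta e1 e2 e3 e4 e5 e6 mkJ_eta.
Qed.

Lemma mkJ_P X : exists a1 a2 a3 x1 x2 x3, X = mkJ a1 a2 a3 x1 x2 x3.
Proof. by rewrite -(mkJ_eta X); do 6!eexists. Qed.

Lemma mkJ_congr a1 a2 a3 x1 x2 x3 b1 b2 b3 y1 y2 y3 :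
  a1 = b1 -> a2 = b2 -> a3 = b3 -> x1 = y1 -> x2 = y2 -> x3 = y3 ->
  mkJ a1 a2 a3 x1 x2 x3 = mkJ b1 b2 b3 y1 y2 y3 :> J R.
Proof. by do 6!move->. Qed.

Lemma mkJ_inj a1 a2 a3 x1 x2 x3 b1 b2 b3 y1 y2 y3 :
  mkJ a1 a2 a3 x1 x2 x3 = mkJ b1 b2 b3 y1 y2 y3 :> J R ->
  [/\ a1 = b1, a2 = b2 & a3 = b3] /\ [/\ x1 = y1, x2 = y2 & x3 = y3].
Proof.
move=> e; split; split.
- by rewrite -(mkJ_xi1 a1 a2 a3 x1 x2 x3) e mkJ_xi1.
- by rewrite -(mkJ_xi2 a1 a2 a3 x1 x2 x3) e mkJ_xi2.
- by rewrite -(mkJ_xi3 a1 a2 a3 x1 x2 x3) e mkJ_xi3.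
- by rewrite -(mkJ_oc1 a1 a2 a3 x1 x2 x3) e mkJ_oc1.
- by rewrite -(mkJ_oc2 a1 a2 a3 x1 x2 x3) e mkJ_oc2.
- by rewrite -(mkJ_oc3 a1 a2 a3 x1 x2 x3) e mkJ_oc3.
Qed.

Lemma mkJD a1 a2 a3 x1 x2 x3 b1 b2 b3 y1 y2 y3 :
  mkJ a1 a2 a3 x1 x2 x3 + mkJ b1 b2 b3 y1 y2 y3 =
  mkJ (a1 + b1) (a2 + b2) (a3 + b3) (x1 + y1) (x2 + y2) (x3 + y3) :> J R.
Proof.
apply: J_ext; rewrite mkJE /xi1 /xi2 /xi3 /oc1 /oc2 /oc3 entryD ?cd_reD.
all: by rewrite !entry_mkJ //= !re_oreal.
Qed.

Lemma mkJZ r a1 a2 a3 x1 x2 x3 :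
  r *: mkJ a1 a2 a3 x1 x2 x3 =
  mkJ (r * a1) (r * a2) (r * a3) (r *: x1) (r *: x2) (r *: x3) :> J R.
Proof.
apply: J_ext; rewrite mkJE /xi1 /xi2 /xi3 /oc1 /oc2 /oc3 entryZ ?cd_reZ.
all: by rewrite !entry_mkJ //= !re_oreal.
Qed.

Lemma mkJN a1 a2 a3 x1 x2 x3 :
  - mkJ a1 a2 a3 x1 x2 x3 =
  mkJ (- a1) (- a2) (- a3) (- x1) (- x2) (- x3) :> J R.
Proof. by rewrite -scaleN1r mkJZ !mulN1r !scaleN1r. Qed.

Lemma trJE X : trJ X = xi1 X + xi2 X + xi3 X.
Proof.
rewrite /trJ !big_ord_recl big_ord0 addr0 addrA.
do ![congr (_ + _)]; congr (cd_re (mx_of_J X _ _)).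
all: by apply/val_inj; rewrite /= !inordK.
Qed.

Lemma cd_re_conjl n (x y : cd R n) : cd_re (cd_mul (cd_conj x) y) = cd_dot x y.
Proof. by rewrite cd_reC -/(cd_dot y x) cd_dotC. Qed.

Lemma cd_re_conjr n (x y : cd R n) : cd_re (cd_mul x (cd_conj y)) = cd_dot x y.
Proof. by []. Qed.

Lemma jordan_mkJ a1 a2 a3 x1 x2 x3 b1 b2 b3 y1 y2 y3 :
  2 *: jordan (mkJ a1 a2 a3 x1 x2 x3) (mkJ b1 b2 b3 y1 y2 y3) =
  mkJ (2 * (a1 * b1 + cd_dot x2 y2 + cd_dot x3 y3))
      (2 * (a2 * b2 + cd_dot x3 y3 + cd_dot x1 y1))
      (2 * (a3 * b3 + cd_dot x1 y1 + cd_dot x2 y2))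
      (cd_conj (cd_mul x2 y3) + cd_conj (cd_mul y2 x3)
       + (b2 + b3) *: x1 + (a2 + a3) *: y1)
      (cd_conj (cd_mul x3 y1) + cd_conj (cd_mul y3 x1)
       + (b3 + b1) *: x2 + (a3 + a1) *: y2)
      (cd_conj (cd_mul x1 y2) + cd_conj (cd_mul y1 x2)
       + (b1 + b2) *: x3 + (a1 + a2) *: y3) :> J R.
Proof.
apply: J_ext; rewrite mkJE /xi1 /xi2 /xi3 /oc1 /oc2 /oc3 entryZ ?cd_reZ.
all: rewrite entry_jordan !entry_mkJ //= !(oreal_mull, oreal_mulr).
all: rewrite /oreal; generic_index.
1-3: rewrite !(cd_re_conjl, cd_re_conjr, cd_reD, cd_reZ) cd_re_one.
1-3: by rewrite ?(cd_dotC y1) ?(cd_dotC y2) ?(cd_dotC y3); field.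
all: rewrite scalerA divff ?pnatr_eq0// scale1r !cd_conjM.
all: vring.
Qed.

Lemma dotJ_mkJ a1 a2 a3 x1 x2 x3 b1 b2 b3 y1 y2 y3 :
  dotJ (mkJ a1 a2 a3 x1 x2 x3) (mkJ b1 b2 b3 y1 y2 y3) =
  a1 * b1 + a2 * b2 + a3 * b3
  + 2 * (cd_dot x1 y1 + cd_dot x2 y2 + cd_dot x3 y3).
Proof.
have trZ r X : trJ (r *: X) = r * trJ X.
  by rewrite -[X in _ *: X]mkJ_eta mkJZ !trJE !mkJE !mulrDr.
have n2 : 2 != 0 :> R by rewrite pnatr_eq0.
apply: (mulfI n2).
by rewrite -trZ jordan_mkJ trJE !mkJE; generic_index; ring.
Qed.

Lemma freudenthal_mkJ a1 a2 a3 x1 x2 x3 b1 b2 b3 y1 y2 y3 :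
  freudenthal (mkJ a1 a2 a3 x1 x2 x3) (mkJ b1 b2 b3 y1 y2 y3) = 2^-1 *:
  mkJ (a2 * b3 + a3 * b2 - 2 * cd_dot x1 y1)
      (a3 * b1 + a1 * b3 - 2 * cd_dot x2 y2)
      (a1 * b2 + a2 * b1 - 2 * cd_dot x3 y3)
      (cd_conj (cd_mul x2 y3) + cd_conj (cd_mul y2 x3) - a1 *: y1 - b1 *: x1)
      (cd_conj (cd_mul x3 y1) + cd_conj (cd_mul y3 x1) - a2 *: y2 - b2 *: x2)
      (cd_conj (cd_mul x1 y2) + cd_conj (cd_mul y1 x2) - a3 *: y3 - b3 *: x3).
Proof.
rewrite /freudenthal jordan_mkJ dotJ_mkJ !trJE !mkJE /EJ; congr (_ *: _).
rewrite !(mkJZ, mkJN, mkJD); apply: mkJ_congr; first 3 last.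
all: generic_index; first [ring | vring].
Qed.

(** The analogue of the adjugate matrix; its zeros play the role of matrices of rank at most one. *)
Definition sharp X := freudenthal X X.

Lemma sharp_mkJ a1 a2 a3 x1 x2 x3 :
  sharp (mkJ a1 a2 a3 x1 x2 x3) =
  mkJ (a2 * a3 - cd_dot x1 x1) (a3 * a1 - cd_dot x2 x2) (a1 * a2 - cd_dot x3 x3)
      (cd_conj (cd_mul x2 x3) - a1 *: x1)
      (cd_conj (cd_mul x3 x1) - a2 *: x2)
      (cd_conj (cd_mul x1 x2) - a3 *: x3).
Proof.
rewrite /sharp freudenthal_mkJ mkJZ; apply: mkJ_congr; first 3 last.
all: generic_index; first [by field | idtac].
1-3: by move: (cd_conj _) => p; apply/rowP => j; rewrite !mxE; field.
Qed.

Lemma freudenthalDl X Y Z :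
  freudenthal (X + Y) Z = freudenthal X Z + freudenthal Y Z.
Proof.
have [a1 [a2 [a3 [x1 [x2 [x3 ->]]]]]] := mkJ_P X.
have [b1 [b2 [b3 [y1 [y2 [y3 ->]]]]]] := mkJ_P Y.
have [c1 [c2 [c3 [z1 [z2 [z3 ->]]]]]] := mkJ_P Z.
rewrite mkJD !freudenthal_mkJ -scalerDr mkJD; congr (_ *: _).
apply: mkJ_congr; first 3 last.
all: generic_index; rewrite ?(cd_mulDl, cd_mulDr, cd_dotDl, cd_conjD).
all: first [ring | vring].
Qed.

Lemma freudenthalC X Y : freudenthal X Y = freudenthal Y X.
Proof.
have [a1 [a2 [a3 [x1 [x2 [x3 ->]]]]]] := mkJ_P X.
have [b1 [b2 [b3 [y1 [y2 [y3 ->]]]]]] := mkJ_P Y.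
rewrite !freudenthal_mkJ; congr (_ *: _).
apply: mkJ_congr; first 3 last.
all: generic_index; rewrite ?(cd_dotC x1) ?(cd_dotC x2) ?(cd_dotC x3).
all: first [ring | vring].
Qed.

Lemma freudenthal_polar X Y :
  sharp (X + Y) = sharp X + sharp Y + 2 *: freudenthal X Y.
Proof.
rewrite /sharp freudenthalDl ![freudenthal _ (X + Y)]freudenthalC.
rewrite !freudenthalDl (freudenthalC Y X).
move: (freudenthal X X) (freudenthal X Y) (freudenthal Y Y) => A B C.
by rewrite scaler_nat mulr2n [RHS]addrACA (addrC C).
Qed.

(** The form b is recovered from q, as 2 b v w = q (v + w) - q v - q w and 2 is invertible. *)
Lemma polar_morph (V : lmodType R) (f q : V -> V) (b : V -> V -> V) :
  linear f -> (forall v w, q (v + w) = q v + q w + 2 *: b v w) ->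
  {morph f : v / q v} -> {morph f : v w / b v w}.
Proof.
move=> lf qD fq v w.
have fD : {morph f : v w / v + w}.
  by move=> a c; rewrite -[a in LHS]scale1r lf scale1r.
have fDZ a r c : f (a + r *: c) = f a + r *: f c.
  by rewrite addrC lf addrC.
have := fq (v + w); rewrite fD !qD fDZ fD !fq => /addrI.
by apply: scalerI; rewrite pnatr_eq0.
Qed.

Lemma F4_of_sharp (f g : J R -> J R) : linear f -> cancel f g -> cancel g f ->
  {morph f : X / sharp X} -> F4 f.
Proof.
move=> lf fK gK fS; split; first by split; last exists g.
exact: polar_morph lf freudenthal_polar fS.
Qed.

End JordanCoordinates.

(** * The group F_4, its reflections, and the stabiliser of the line through E_1 *)

Section F4Theory.
Variable R : realType.
Local Notation O := (octonion R).
Implicit Types (X Y Z : J R) (c r : R) (u x y z : O) (f g : J R -> J R).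

Lemma F4_comp f g : F4 f -> F4 g -> F4 (f \o g).
Proof.
move=> [[lf bf] fM] [[lg bg] gM]; split; last by move=> X Y /=; rewrite gM fM.
by split; [move=> r X Y /=; rewrite lg lf | exact: bij_comp].
Qed.

Lemma F4_inv f : F4 f -> exists g, [/\ F4 g, cancel f g & cancel g f].
Proof.
move=> [[lf [g fK gK]] fM]; exists g.
split; [|exact: fK|exact: gK].
have fI := can_inj fK; split; first (split; last by exists f).
- by move=> r X Y; apply: fI; rewrite lf !gK.
- by move=> X Y; apply: fI; rewrite fM !gK.
Qed.

Lemma F4_0 f : F4 f -> f 0 = 0.
Proof.
move=> [[lf _] _]; have := lf 1 0 0; rewrite !scale1r addr0 => /eqP.
by rewrite -subr_eq0 opprD addrA subrr sub0r oppr_eq0 => /eqP.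
Qed.

Lemma F4_sharp f X : F4 f -> f (sharp X) = sharp (f X).
Proof. by case=> _; apply. Qed.

Lemma F4_sharp0 f X : F4 f -> sharp X = 0 -> sharp (f X) = 0.
Proof. by move=> Ff X0; rewrite -(F4_sharp X Ff) X0 (F4_0 Ff). Qed.

Lemma E1E : E1 = mkJ 1 0 0 0 0 0 :> J R. Proof. by []. Qed.
Lemma E2E : E2 = mkJ 0 1 0 0 0 0 :> J R. Proof. by []. Qed.

Lemma mkJ0 : mkJ 0 0 0 0 0 0 = 0 :> J R.
Proof. by rewrite -[RHS](scale0r E1) E1E mkJZ !mul0r !scale0r. Qed.

(** Conjugation by a cyclic permutation matrix. It maps E_2 to E_1, hence conjugates [Spin1_9] into
    [Spin2_9]. *)
Definition cyc X := mkJ (xi2 X) (xi3 X) (xi1 X) (oc2 X) (oc3 X) (oc1 X).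

Lemma cyc_mkJ (a1 a2 a3 : R) (x1 x2 x3 : O) :
  cyc (mkJ a1 a2 a3 x1 x2 x3) = mkJ a2 a3 a1 x2 x3 x1.
Proof. by rewrite /cyc !mkJE. Qed.

Lemma cycK X : cyc (cyc (cyc X)) = X.
Proof. by rewrite /cyc !mkJE mkJ_eta. Qed.

Lemma F4_cyc : F4 cyc.
Proof.
apply: (@F4_of_sharp _ cyc (cyc \o cyc)); [|exact: cycK|exact: cycK|].
  move=> r X Y.
  have [a1 [a2 [a3 [x1 [x2 [x3 ->]]]]]] := mkJ_P X.
  have [b1 [b2 [b3 [y1 [y2 [y3 ->]]]]]] := mkJ_P Y.
  by rewrite mkJZ mkJD !cyc_mkJ mkJZ mkJD.
move=> X; have [a1 [a2 [a3 [x1 [x2 [x3 ->]]]]]] := mkJ_P X.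
by rewrite sharp_mkJ !cyc_mkJ sharp_mkJ.
Qed.

(** This is 2 <w, v> for w = (c, u) and v = ((xi_2 - xi_3) / 2, x_1), the traceless part of the
    lower block. *)
Definition refl_coef c u X := c * (xi2 X - xi3 X) + 2 * cd_dot u (oc1 X).

(* X |-> W X W for the Hermitian W = diag (1, [[c, u], [conj u, - c]]). *)
Definition refl c u X :=
  let k := refl_coef c u X in
  mkJ (xi1 X) (xi3 X + c * k) (xi2 X - c * k)
      (k *: u - oc1 X)
      (cd_conj (cd_mul (oc3 X) u) - c *: oc2 X)
      (c *: oc3 X + cd_conj (cd_mul u (oc2 X))).

Lemma refl_mkJ c u (a1 a2 a3 : R) (x1 x2 x3 : O) :
  refl c u (mkJ a1 a2 a3 x1 x2 x3) =
  let k := c * (a2 - a3) + 2 * cd_dot u x1 in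
  mkJ a1 (a3 + c * k) (a2 - c * k) (k *: u - x1)
      (cd_conj (cd_mul x3 u) - c *: x2) (c *: x3 + cd_conj (cd_mul u x2)).
Proof. by rewrite /refl /refl_coef !mkJE. Qed.

Let cd_linE := (cd_mulDl, cd_mulDr, cd_mulNl, cd_mulNr, cd_mulZl, cd_mulZr,
  cd_conjD, cd_conjN, cd_conjZ, cd_dotDl, cd_dotDr, cd_dotNl, cd_dotNr,
  cd_dotZl, cd_dotZr).

Lemma refl_linear c u : linear (refl c u).
Proof.
move=> r X Y.
have [a1 [a2 [a3 [x1 [x2 [x3 ->]]]]]] := mkJ_P X.
have [b1 [b2 [b3 [y1 [y2 [y3 ->]]]]]] := mkJ_P Y.
rewrite mkJZ mkJD !refl_mkJ mkJZ mkJD; apply: mkJ_congr => //.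
all: generic_index; rewrite !cd_linE; first [ring | vring].
Qed.

Lemma reflK c u : c ^+ 2 + cd_dot u u = 1 ->
  cancel (refl c u) (refl c u).
Proof.
move=> cu X; have [a1 [a2 [a3 [x1 [x2 [x3 ->]]]]]] := mkJ_P X.
have uu : cd_dot u u = 1 - c ^+ 2 by rewrite -cu [c ^+ 2 + _]addrC addrK.
have mN := @oct_composition R.
rewrite !refl_mkJ /=; set k := c * (a2 - a3) + _.
(* The map v |-> 2 <w, v> w - v is orthogonal and fixes w, so the pairing with w is unchanged. *)
have -> : c * (a3 + c * k - (a2 - c * k)) + 2 * cd_dot u (k *: u - x1) = k.
  by rewrite /k; clear k; generic_index; rewrite !cd_linE uu; ring.
apply: mkJ_congr => //; try ring; clearbody k.
all: generic_index; rewrite ?(cd_linE, cd_conjM, cd_conjK).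
- by vring.
- by rewrite (cd_conjKM mN) uu; vring.
- by rewrite (cd_mul_conjK mN) uu; vring.
Qed.

Lemma refl_sharp c u : c ^+ 2 + cd_dot u u = 1 ->
  {morph refl c u : X / sharp X}.
Proof.
move=> cu X; have [a1 [a2 [a3 [x1 [x2 [x3 ->]]]]]] := mkJ_P X.
have uu : cd_dot u u = 1 - c ^+ 2 by rewrite -cu [c ^+ 2 + _]addrC addrK.
have mN := @oct_composition R.
rewrite sharp_mkJ !refl_mkJ sharp_mkJ /=; apply: mkJ_congr; clear cu.
- generic_index; rewrite !cd_linE uu (cd_dotC x1 u); ring.
- have x3ux2 : cd_dot (cd_conj (cd_mul x3 u)) x2 =
               cd_dot u (cd_conj (cd_mul x2 x3)).
    generic_index.
    by rewrite cd_conjM cd_dot_mulr -cd_dot_conj !cd_conjK.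
  generic_index; rewrite !cd_linE (cd_dotC x2) !cd_dot_conj x3ux2 (mN x3 u) uu.
  by ring.
- have x3ux2 : cd_dot x3 (cd_conj (cd_mul u x2)) =
               cd_dot u (cd_conj (cd_mul x2 x3)).
    generic_index.
    by rewrite cd_dotC -cd_dot_conj cd_conjK cd_dot_mulr -cd_conjM.
  generic_index; rewrite !cd_linE (cd_dotC _ x3) !cd_dot_conj x3ux2 (mN u x2).
  by rewrite uu; ring.
(* In the x_1 entry the product of the two new spinor entries contains (u x_2) (x_3 u), which calls
   for the Moufang identity. *)
- generic_index; rewrite [in RHS]cd_conjM !(cd_linE, cd_conjK).
  rewrite (cd_conjKM mN) (cd_mul_conjK mN) (cd_moufang mN) -cd_conjM uu.
  by vring.
(* Here conj u (x_1 x_2) and conj x_1 (u x_2) appear on opposite sides; the polarised cancellation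
   law relates them. The x_3 entry is the mirror image. *)
- generic_index; have xu := cd_conjKM_lin mN u x1 x2.
  rewrite !(cd_linE, cd_conjM, cd_conjK) (cd_conjKM mN) uu.
  move/eqP: xu; rewrite -subr_eq0 => /eqP xu.
  by apply/subr0_eq; rewrite -[RHS]xu; vring.
- generic_index; have xu := cd_mul_conjK_lin mN u x1 x3.
  rewrite !(cd_linE, cd_conjM, cd_conjK) (cd_mul_conjK mN) uu.
  move/eqP: xu; rewrite -subr_eq0 => /eqP xu.
  by apply/subr0_eq; rewrite -[RHS]xu; vring.
Qed.

Lemma refl_Spin1 c u : c ^+ 2 + cd_dot u u = 1 -> Spin1_9 (refl c u).
Proof.
move=> cu; split.
  exact: (F4_of_sharp (@refl_linear c u) (reflK cu) (reflK cu) (refl_sharp cu)).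
rewrite E1E refl_mkJ /=; apply: mkJ_congr => //; generic_index.
all: rewrite !(cd_mul0l, cd_mul0r, cd_conj0, cd_dot0r).
all: by rewrite ?(scaler0, scale0r, mulr0, subr0, addr0).
Qed.

(* With h = (a2 + a3) / 2, the witness (c, u) is the unit vector along *)
(* ((a2 - a3) / 2, x) - (h, 0) = (- a3, x), unless that vector is zero. *)
Lemma refl_coef_exists (a2 a3 : R) x : a2 * a3 = cd_dot x x ->
  exists c u, c ^+ 2 + cd_dot u u = 1 /\
              a3 + c * (c * (a2 - a3) + 2 * cd_dot u x) = 0.
Proof.
move=> det0; set N := a3 ^+ 2 + cd_dot x x.
have [N0|N_neq0] := eqVneq N 0.
  (* Now a3 = 0 already, and c = 0 removes the correction term; the unit octonion only meets the
     norm condition. *)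
  exists 0, (cd_one R 3).
  rewrite /cd_dot cd_conj1 cd_mul1l cd_re_one expr0n add0r mul0r addr0.
  split=> //.
  apply/eqP; rewrite -sqrf_eq0.
  by move/eqP: N0; rewrite paddr_eq0 ?sqr_ge0 ?cd_dot_ge0 // => /andP[].
have N_gt0 : 0 < N by rewrite lt0r N_neq0 addr_ge0 ?sqr_ge0 ?cd_dot_ge0.
pose s := Num.sqrt N; have s2 : s ^+ 2 = N by rewrite sqr_sqrtr // ltW.
have s_neq0 : s != 0 by rewrite sqrtr_eq0 -ltNge.
exists (- a3 / s), (s^-1 *: x); rewrite !(cd_dotZl, cd_dotZr).
have xx : cd_dot x x = s ^+ 2 - a3 ^+ 2 by rewrite s2 /N addrC addKr.
split; first by rewrite xx; field.
apply: (mulfI (expf_neq0 2 s_neq0)); rewrite mulr0.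
have -> : s ^+ 2 * (a3 + - a3 / s * (- a3 / s * (a2 - a3)
                                     + 2 * (s^-1 * cd_dot x x))) =
          a3 * (s ^+ 2 + a3 * a2 - a3 ^+ 2 - 2 * cd_dot x x) by field.
by rewrite s2 /N (mulrC a3 a2) det0; ring.
Qed.

Lemma sharp0_clear (a1 a3 : R) (x1 x2 x3 : O) :
  sharp (mkJ a1 0 a3 x1 x2 x3) = 0 -> x1 = 0 /\ x3 = 0.
Proof.
have dot0 x : 0 - cd_dot x x = 0 -> x = 0.
  by rewrite sub0r => /eqP; rewrite oppr_eq0 => /eqP/cd_dot_eq0.
rewrite sharp_mkJ -mkJ0 mul0r mulr0 => /mkJ_inj[[x1_0 _ x3_0] _].
exact: (conj (dot0 _ x1_0) (dot0 _ x3_0)).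
Qed.

(** The minor xi_2 xi_3 = |x_1|^2 is the hypothesis of [refl_coef_exists]. That [xi1 X] survives
    matters in the second use, where it is already zero. *)
Lemma Spin1_clear X : sharp X = 0 ->
  exists f, Spin1_9 f /\ exists (a3 : R) x2, f X = mkJ (xi1 X) 0 a3 0 x2 0.
Proof.
have [a1 [a2 [a3 [x1 [x2 [x3 ->]]]]]] := mkJ_P X => X0.
have det0 : a2 * a3 = cd_dot x1 x1.
  by move: X0; rewrite sharp_mkJ -mkJ0 => /mkJ_inj[[/subr0_eq-> _ _] _].
have [c [u [cu c0]]] := refl_coef_exists det0.
have fS := refl_Spin1 cu; exists (refl c u); split; first exact: fS.
have := F4_sharp (mkJ a1 a2 a3 x1 x2 x3) fS.1.
rewrite X0 (F4_0 fS.1) refl_mkJ /= c0 mkJE => /esym/sharp0_clear[-> ->].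
by do 2!eexists.
Qed.

(** For r = 1 the eigenvalues are 1/2, -1/2 and 0; the scalar r is kept to compare the spectrum of
    E_1 with that of its multiples. *)
Lemma freudenthal_E1 r (a1 a2 a3 : R) (x1 x2 x3 : O) :
  freudenthal (r *: E1) (mkJ a1 a2 a3 x1 x2 x3) =
  (r / 2) *: mkJ 0 a3 a2 (- x1) 0 0.
Proof.
rewrite E1E mkJZ freudenthal_mkJ !mkJZ; apply: mkJ_congr; generic_index.
all: rewrite !(scaler0, cd_mul0l, cd_mul0r, cd_conj0, cd_dot0l, mulr0).
all: first [ring | vring].
Qed.

Lemma F4Z f r X : F4 f -> f (r *: X) = r *: f X.
Proof. by move=> Ff; rewrite -[r *: X]addr0 Ff.1.1 (F4_0 Ff) addr0. Qed.

(* The eigenspace of E1 x _ for - 1/2 contains two independent vectors, *)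
(* while that of s E1 x _ is a line unless s = 1.                       *)
Lemma F4_scale_E1 f s : F4 f -> f E1 = s *: E1 -> s = 1.
Proof.
move=> Ff fE1; have fI := bij_inj Ff.1.2.
apply/eqP/negPn/negP => s_neq1.
have half0 (y : O) : 0 = - 2^-1 *: y -> y = 0.
  move/esym/eqP; rewrite scaler_eq0 oppr_eq0 invr_eq0 pnatr_eq0 /=.
  by move/eqP.
have eig A : freudenthal E1 A = - 2^-1 *: A ->
    exists b, f A = mkJ 0 (- (s * b)) b 0 0 0.
  move=> /(congr1 f); rewrite Ff.2 fE1 (F4Z _ _ Ff).
  have [b1 [b2 [b3 [y1 [y2 [y3 ->]]]]]] := mkJ_P (f A).
  rewrite freudenthal_E1 !mkJZ => /mkJ_inj[[e1 e2 e3] [e4 e5 e6]].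
  exists b3; apply: mkJ_congr => //; [lra|lra| | |].
  - move/eqP: e4; rewrite scalerN -scaleNr -subr_eq0 -scalerBl scaler_eq0.
    case/orP=> /eqP // s1; case/eqP: s_neq1; lra.
  - by apply: half0; rewrite -e5 scaler0.
  - by apply: half0; rewrite -e6 scaler0.
pose A1 : J R := mkJ 0 1 (- 1) 0 0 0.
pose A2 : J R := mkJ 0 0 0 (cd_one R 3) 0 0.
have E1A a2 a3 x : freudenthal E1 (mkJ 0 a2 a3 x 0 0) =
    2^-1 *: mkJ 0 a3 a2 (- x) 0 0.
  by rewrite -[E1]scale1r freudenthal_E1 mul1r.
have [|b1 fA1] := eig A1.
  by rewrite E1A !mkJZ; apply: mkJ_congr; rewrite ?(oppr0, scaler0) //; ring.
have [|b2 fA2] := eig A2.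
  rewrite E1A !mkJZ; apply: mkJ_congr; rewrite ?scaler0 ?mulr0 //.
  by rewrite scalerN scaleNr.
(* Both images lie on the line spanned by (0, - s, 1; 0, 0, 0), so injectivity of f gives a linear
   relation between the independent [A1] and [A2]. *)
have : b2 *: A1 = b1 *: A2.
  apply: fI; rewrite !(F4Z _ _ Ff) fA1 fA2 !mkJZ !scaler0.
  by apply: mkJ_congr; rewrite ?mulr0 //; ring.
rewrite !mkJZ => /mkJ_inj[[_ + _] _]; rewrite mulr1 mulr0 => b2_0.
have : A2 = 0.
  apply: fI; rewrite (F4_0 Ff) fA2 b2_0 mulr0 oppr0; exact: mkJ0.
rewrite -mkJ0 => /mkJ_inj[_ [/(congr1 (@cd_re R 3))]].
by rewrite cd_re_one cd_re0 => /eqP; rewrite oner_eq0.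
Qed.

Lemma sharp_E1 : sharp E1 = 0 :> J R.
Proof.
rewrite E1E sharp_mkJ -mkJ0; apply: mkJ_congr; generic_index.
all: rewrite ?(cd_mul0l, cd_dot0l, cd_conj0, scaler0).
all: by rewrite ?(mulr0, mul0r, subr0).
Qed.

Lemma cyc_E1 : cyc (cyc E1) = E2 :> J R.
Proof. by rewrite E1E E2E !cyc_mkJ. Qed.

Lemma cyc_E2 : cyc E2 = E1 :> J R.
Proof. by rewrite E1E E2E !cyc_mkJ. Qed.

End F4Theory.

Theorem theorem5 (R : realType) (alpha : J R -> J R) (halpha : F4 alpha) :
  exists alpha1 alpha2 alpha1' : J R -> J R,
    [/\ Spin1_9 alpha1, Spin2_9 alpha2, Spin1_9 alpha1'
      & alpha =1 alpha1 \o alpha2 \o alpha1'].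
Proof.
have X0 := F4_sharp0 halpha (sharp_E1 R).
have [beta [Sbeta [a3 [x2 betaE]]]] := Spin1_clear X0.
have Fcyc := F4_cyc R; have F4beta := Sbeta.1.
have Z0 := F4_sharp0 Fcyc (F4_sharp0 F4beta X0).
have [g [Sg [b3 [y2 gE]]]] := Spin1_clear Z0.
(* The rotation brings the cleared xi_2 to the first place, which [g] leaves alone. *)
have xi1_0 : xi1 (cyc (beta (alpha E1))) = 0 by rewrite betaE cyc_mkJ mkJ_xi1.
rewrite xi1_0 in gE.
(* Two more rotations put the remaining octonion [y2] in the x_3 position, next to a zero xi_2, so
   it vanishes as well. *)
have := F4_sharp0 Fcyc (F4_sharp0 Fcyc (F4_sharp0 Sg.1 Z0)).
rewrite gE !cyc_mkJ => /sharp0_clear[_ y2_0].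
(* As [cyc] has order 3, this is the conjugate of [g] by [cyc]. *)
pose gamma := @cyc R \o (@cyc R \o (g \o @cyc R)).
have Fgamma : F4 gamma.
  exact: (F4_comp Fcyc (F4_comp Fcyc (F4_comp Sg.1 Fcyc))).
have gammaE2 : gamma E2 = E2 by rewrite /gamma /= cyc_E2 Sg.2 cyc_E1.
have Fdelta := F4_comp Fgamma (F4_comp F4beta halpha).
have deltaE : (gamma \o (beta \o alpha)) E1 = b3 *: E1.
  rewrite /gamma /= gE y2_0 !cyc_mkJ E1E mkJZ.
  by rewrite !scaler0 mulr0 mulr1.
have b3_1 := F4_scale_E1 Fdelta deltaE.
have [beta' [Fbeta' betaK betaK']] := F4_inv F4beta.
have [gamma' [Fgamma' gammaK gammaK']] := F4_inv Fgamma.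
exists beta', gamma', (gamma \o (beta \o alpha)); split.
- by split; [exact: Fbeta' | rewrite -{1}Sbeta.2 betaK].
- by split; [exact: Fgamma' | rewrite -{1}gammaE2 gammaK].
- by split; [exact: Fdelta | rewrite deltaE b3_1 scale1r].
- by move=> X; rewrite /= gammaK betaK.
Qed.
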